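(* Let $\mathbb F$ be a field of characteristic different from $2$ and $3$ containing a primitive cubic root $\omega$ of $1$, let $\epsilon,\delta\in\{1,-1\}$ and let $(U,xyz)$ be an arbitrary (not necessarily special) $(\epsilon,\delta)$ Freudenthal-Kantor triple system over $\mathbb F$. Let $\mathfrak g(U)=\mathcal L\oplus\mathcal T$ be the attached $5$-graded Lie algebra (if $\delta=1$) or Lie superalgebra (if $\delta=-1$) described in the context. Let $\phi:\mathfrak g(U)\to\mathfrak g(U)$ be the linear map with $\phi(X)=\omega^iX$ for $X\in\mathfrak g(U)_{(i)}$, $-2\le i\le2$, and let $\theta$ be the linear map given on $\mathcal T$ by $\theta\begin{pmatrix}a\\ b\end{pmatrix}=\begin{pmatrix}-\epsilon b\\ \delta a\end{pmatrix}$ and on $\mathcal L\subseteq\mathrm{End}_{\mathbb F}(\mathcal T)$ by $\theta(M)=\theta M\theta^{-1}$. Then $\theta$ and $\phi$ are automorphisms of the Lie (super)algebra $\mathfrak g(U)$ satisfying $\theta^4=1=\phi^3$ and $\phi\theta\phi=\theta$, so that $\mathfrak g(U)$ is endowed with an action by automorphisms of the dicyclic group $\mathrm{Dic}_3=\langle\theta,\phi:\theta^4=1=\phi^3,\ \phi\theta\phi=\theta\rangle$. If $\delta=-\epsilon$, then $\theta^2=1$ and this action reduces to an action of the symmetric group $S_3$.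
   Context: An $(\epsilon,\delta)$ Freudenthal-Kantor triple system is a vector space $U$ with a trilinear product $xyz$ such that, with $L(x,y)z=xyz$ and $K(x,y)z=xzy-\delta\,yzx$, for all $x,y,u,v\in U$: $[L(u,v),L(x,y)]=L(L(u,v)x,y)+\epsilon L(x,L(v,u)y)$ and $K(K(u,v)x,y)=L(y,x)K(u,v)-\epsilon K(u,v)L(x,y)$. Let $\mathcal T$ be the space of columns $\begin{pmatrix}x\\ y\end{pmatrix}$, $x,y\in U$, identify $\mathrm{Mat}_2(\mathrm{End}_{\mathbb F}(U))$ with $\mathrm{End}_{\mathbb F}(\mathcal T)$, and let $$\mathcal L=\mathrm{span}\left\{\begin{pmatrix}L(a,b)&K(c,d)\\ K(e,f)&\epsilon L(b,a)\end{pmatrix}:a,b,c,d,e,f\in U\right\},$$ which is a Lie subalgebra of $\mathrm{Mat}_2(\mathrm{End}_{\mathbb F}(U))$ under the commutator. It is known that $\mathfrak g(U)=\mathcal L\oplus\mathcal T$ is a $\mathbb Z_2$-graded Lie algebra if $\delta=1$, and a Lie superalgebra if $\delta=-1$, with even part $\mathcal L$ and odd part $\mathcal T$, under the bracket consisting of the commutator on $\mathcal L$, $[M,X]=M(X)$ for $M\in\mathcal L$, $X\in\mathcal T$, and $$\left[\begin{pmatrix}a_1\\ b_1\end{pmatrix},\begin{pmatrix}a_2\\ b_2\end{pmatrix}\right]=\begin{pmatrix}L(a_1,b_2)-\delta L(a_2,b_1)&\delta K(a_1,a_2)\\ -\epsilon K(b_1,b_2)&\epsilon L(b_2,a_1)-\epsilon\delta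 L(b_1,a_2)\end{pmatrix}.$$ It is $5$-graded, $\mathfrak g(U)=\bigoplus_{i=-2}^2\mathfrak g(U)_{(i)}$, where $\mathfrak g(U)_{(0)}$ is spanned by the matrices $\begin{pmatrix}L(a,b)&0\\ 0&\epsilon L(b,a)\end{pmatrix}$, $\mathfrak g(U)_{(1)}=\begin{pmatrix}U\\ 0\end{pmatrix}$, $\mathfrak g(U)_{(-1)}=\begin{pmatrix}0\\ U\end{pmatrix}$, $\mathfrak g(U)_{(2)}$ is spanned by the matrices $\begin{pmatrix}0&K(a,b)\\ 0&0\end{pmatrix}$, and $\mathfrak g(U)_{(-2)}$ by the matrices $\begin{pmatrix}0&0\\ K(a,b)&0\end{pmatrix}$. *)

(* Defs.v *)
From HB Require Import structures.
From mathcomp Require Import all_boot all_order all_algebra.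
From mathcomp Require Import all_fingroup all_solvable.
From mathcomp Require Import boolp classical_sets functions.

Set Implicit Arguments.
Unset Strict Implicit.
Unset Printing Implicit Defensive.

Import Order.TTheory GRing.Theory Num.Theory.

Local Open Scope ring_scope.

Section Span.
Variables (F : fieldType) (V : lmodType F).

Definition lin_span (A : set V) : set V :=
  [set v | exists n (c : 'I_n -> F) (x : 'I_n -> V),
     (forall i, A (x i)) /\ v = \sum_(i < n) c i *: x i].

Lemma lin_span_gen (A : set V) v : A v -> lin_span A v.
Proof.
move=> Av; exists 1%N, (fun=> 1), (fun=> v); split=> //.
by rewrite big_ord1 scale1r.
Qed.

Lemma lin_span0 (A : set V) : lin_span A 0.
Proof. by exists 0%N, (fun=> 0), (fun=> 0); split=> [[]|] //; rewrite big_ord0. Qed.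

Lemma lin_span_lin (A : set V) k u v :
  lin_span A u -> lin_span A v -> lin_span A (k *: u + v).
Proof.
move=> [n [c [x [Ax ->]]]] [m [d [y [Ay ->]]]].
exists (n + m)%N,
  (fun i => match fintype.split i with inl j => k * c j | inr j => d j end),
  (fun i => match fintype.split i with inl j => x j | inr j => y j end).
split=> [i|]; first by case: (fintype.split i).
rewrite big_split_ord /= scaler_sumr; congr (_ + _); apply: eq_bigr => i _.
  by rewrite (unsplitK (inl i)) scalerA.
by rewrite (unsplitK (inr i)).
Qed.

Lemma lin_span_ind (A : set V) (P : V -> Prop) :
  P 0 -> (forall k u v, P u -> P v -> P (k *: u + v)) ->
  (forall v, A v -> P v) -> forall v, lin_span A v -> P v.
Proof.
move=> P0 Plin PA v [n [c [x [Ax ->]]]].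
elim/big_ind: _ => // [u w Pu Pw|i _]; first by rewrite -(scale1r u); exact: Plin.
by rewrite -[_ *: _]addr0; apply: Plin => //; apply: PA.
Qed.

End Span.

Section TripleOperators.
Variables (F : fieldType) (U : lmodType F) (t : U -> U -> U -> U).

Definition opL (x y : U) : U -> U := fun z => t x y z.

Definition opK (delta : F) (x y : U) : U -> U :=
  fun z => t x z y - delta *: t y z x.

End TripleOperators.

(* Linear endomorphisms are represented inside the F-module of functions
   U -> U, where composition is the product of End(U). *)
Record FKTS (F : fieldType) (eps delta : F) (U : lmodType F) := MkFKTS {
  tprod :> U -> U -> U -> U;
  fkts_eps : eps = 1 \/ eps = -1;
  fkts_delta : delta = 1 \/ delta = -1;
  fkts_lin1 : forall y z, linear (fun x => tprod x y z);
  fkts_lin2 : forall x z, linear (fun y => tprod x y z);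
  fkts_lin3 : forall x y, linear (fun z => tprod x y z);
  fkts_LL : forall u v x y,
    (opL tprod u v \o opL tprod x y) - (opL tprod x y \o opL tprod u v) =
    opL tprod (opL tprod u v x) y + eps *: opL tprod x (opL tprod v u y);
  fkts_KK : forall u v x y,
    opK tprod delta (opK tprod delta u v x) y =
    (opL tprod y x \o opK tprod delta u v)
      - eps *: (opK tprod delta u v \o opL tprod x y)
}.

(* A column (x ; y) is the pair (x, y); mx2 A B C D is the 2 x 2 matrix with
   rows (A, B) and (C, D), acting on columns. *)
Definition mx2 (F : fieldType) (U : lmodType F) (A B C D : U -> U) :
    U * U -> U * U :=
  fun X => (A X.1 + B X.2, C X.1 + D X.2).

Definition comm_op (F : fieldType) (V : lmodType F) (M N : V -> V) : V -> V :=
  (M \o N) - (N \o M).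

Section StandardEmbedding.
Variables (F : fieldType) (eps delta : F) (U : lmodType F).
Variable S : FKTS eps delta U.

Local Notation T := (U * U)%type.
Local Notation L := (opL S).
Local Notation K := (opK S delta).

Definition calL_gens : set (T -> T) :=
  [set M | exists a b c d e f : U,
     M = mx2 (L a b) (K c d) (K e f) (eps *: L b a)].

Definition calL_pred : {pred T -> T} := fun M => `[< lin_span calL_gens M >].

Lemma calLP M : reflect (lin_span calL_gens M) (M \in calL_pred).
Proof. exact: asboolP. Qed.

Lemma calL_submod_closed : submod_closed calL_pred.
Proof.
split; first by apply/calLP; exact: lin_span0.
by move=> k M N /calLP hM /calLP hN; apply/calLP; exact: lin_span_lin.
Qed.

HB.instance Definition _ :=
  GRing.isSubmodClosed.Build F (T -> T) calL_pred calL_submod_closed.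

(* Elements of the span are automatically F-linear: see calL_linear. *)
Record calL := CalL { calL_val :> T -> T; calL_valP : calL_val \in calL_pred }.

HB.instance Definition _ := [isSub for calL_val].
HB.instance Definition _ := [Choice of calL by <:].
HB.instance Definition _ := [SubChoice_isSubLmodule of calL by <:].

Lemma tprodDl x x' y z : S (x + x') y z = S x y z + S x' y z.
Proof. by have := fkts_lin1 S y z 1 x x'; rewrite !scale1r. Qed.
Lemma tprodDm x y y' z : S x (y + y') z = S x y z + S x y' z.
Proof. by have := fkts_lin2 S x z 1 y y'; rewrite !scale1r. Qed.
Lemma tprodDr x y z z' : S x y (z + z') = S x y z + S x y z'.
Proof. by have := fkts_lin3 S x y 1 z z'; rewrite !scale1r. Qed.
Lemma tprod0l y z : S 0 y z = 0.
Proof. by apply: (addrI (S 0 y z)); rewrite -tprodDl !addr0. Qed.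
Lemma tprod0m x z : S x 0 z = 0.
Proof. by apply: (addrI (S x 0 z)); rewrite -tprodDm !addr0. Qed.
Lemma tprod0r x y : S x y 0 = 0.
Proof. by apply: (addrI (S x y 0)); rewrite -tprodDr !addr0. Qed.
Lemma tprodZl k x y z : S (k *: x) y z = k *: S x y z.
Proof. by have := fkts_lin1 S y z k x 0; rewrite tprod0l !addr0. Qed.
Lemma tprodZm k x y z : S x (k *: y) z = k *: S x y z.
Proof. by have := fkts_lin2 S x z k y 0; rewrite tprod0m !addr0. Qed.
Lemma tprodZr k x y z : S x y (k *: z) = k *: S x y z.
Proof. by have := fkts_lin3 S x y k z 0; rewrite tprod0r !addr0. Qed.
Lemma tprodNl x y z : S (- x) y z = - S x y z.
Proof. by rewrite -scaleN1r tprodZl scaleN1r. Qed.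
Lemma tprodNm x y z : S x (- y) z = - S x y z.
Proof. by rewrite -scaleN1r tprodZm scaleN1r. Qed.
Lemma tprodNr x y z : S x y (- z) = - S x y z.
Proof. by rewrite -scaleN1r tprodZr scaleN1r. Qed.

Definition tprodE := (tprodDl, tprodDm, tprodDr, tprodZl, tprodZm, tprodZr, tprodNl, tprodNm, tprodNr, tprod0l, tprod0m, tprod0r).

Lemma fkts_eps2 : eps * eps = 1.
Proof. by case: (fkts_eps S) => ->; rewrite ?mulrNN mulr1. Qed.
Lemma fkts_delta2 : delta * delta = 1.
Proof. by case: (fkts_delta S) => ->; rewrite ?mulrNN mulr1. Qed.

Lemma opKE x y z : K x y z = S x z y - delta *: S y z x. Proof. by []. Qed.

Lemma opK_linear x y k z z' : K x y (k *: z + z') = k *: K x y z + K x y z'.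
Proof.
rewrite !opKE !tprodE scalerBr !scalerDr !opprD !scalerA [delta * k]mulrC.
by rewrite addrACA.
Qed.

Lemma mx2_linear (A B C D : U -> U) :
  linear A -> linear B -> linear C -> linear D -> linear (mx2 A B C D).
Proof.
move=> hA hB hC hD k [x y] [x' y']; rewrite /mx2 /=.
rewrite -/(k *: (_, _) + _) /=; congr (_, _) => /=.
  by rewrite hA hB scalerDr addrACA.
by rewrite hC hD scalerDr addrACA.
Qed.

Lemma calL_linear (M : calL) : linear M.
Proof.
case: M => M /= /calLP; apply: (@lin_span_ind _ _ _ (fun M : T -> T => linear M)).
- by move=> k x y; rewrite scaler0 addr0.
- move=> k f g hf hg c x y; rewrite !fctE hf hg !scalerDr !scalerA [k * c]mulrC.
  by rewrite addrACA.
move=> _ [a [b [c [d [e [f ->]]]]]]; apply: mx2_linear.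
- by move=> k z z'; rewrite /opL !tprodE.
- exact: opK_linear.
- exact: opK_linear.
move=> k z z'; rewrite /= /opL; rewrite -[LHS]/(eps *: S b a (k *: z + z')) !tprodE.
by rewrite scalerDr !scalerA mulrC.
Qed.

Lemma comm_op_lin (V : lmodType F) k (M N P : V -> V) :
  linear P -> comm_op (k *: M + N) P = k *: comm_op M P + comm_op N P.
Proof.
move=> hP; rewrite /comm_op; apply: funext => x; rewrite !fctE hP opprD scalerBr.
by rewrite addrACA.
Qed.

Lemma comm_opC (V : lmodType F) (M N : V -> V) : comm_op M N = - comm_op N M.
Proof. by rewrite /comm_op opprB. Qed.

Definition diag_op a b := mx2 (L a b) (0 : U -> U) (0 : U -> U) (eps *: L b a).
Definition upper_op c d := mx2 (0 : U -> U) (K c d) (0 : U -> U) (0 : U -> U).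
Definition lower_op e f := mx2 (0 : U -> U) (0 : U -> U) (K e f) (0 : U -> U).

Lemma opL0l a : L 0 a = 0.
Proof. by apply/funext => z; rewrite /opL !tprodE. Qed.
Lemma opL0r a : L a 0 = 0.
Proof. by apply/funext => z; rewrite /opL !tprodE. Qed.
Lemma opK00 : K 0 0 = 0.
Proof. by apply/funext => z; rewrite opKE !tprodE scaler0 subr0. Qed.

Lemma diag_op_in a b : lin_span calL_gens (diag_op a b).
Proof. by apply: lin_span_gen; exists a, b, 0, 0, 0, 0; rewrite opK00. Qed.
Lemma upper_op_in c d : lin_span calL_gens (upper_op c d).
Proof. by apply: lin_span_gen; exists 0, 0, c, d, 0, 0; rewrite opK00 opL0l scaler0. Qed.
Lemma lower_op_in e f : lin_span calL_gens (lower_op e f).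
Proof. by apply: lin_span_gen; exists 0, 0, 0, 0, e, f; rewrite opK00 opL0l scaler0. Qed.

Lemma calL_ind (P : (T -> T) -> Prop) :
  P 0 -> (forall k M N, P M -> P N -> P (k *: M + N)) ->
  (forall a b, P (diag_op a b)) -> (forall c d, P (upper_op c d)) ->
  (forall e f, P (lower_op e f)) -> forall M, lin_span calL_gens M -> P M.
Proof.
move=> P0 Plin PD PE PF; apply: (lin_span_ind P0 Plin) => M [a [b [c [d [e [f ->]]]]]].
have -> : mx2 (L a b) (K c d) (K e f) (eps *: L b a) =
          1 *: diag_op a b + (1 *: upper_op c d + lower_op e f).
  rewrite !scale1r; apply/funext => -[x y]; rewrite /diag_op /upper_op /lower_op /mx2 /=.
  rewrite -[RHS]/(L a b x + 0 + (0 + K c d y + (0 + 0)),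
                  0 + eps *: L b a y + (0 + 0 + (K e f x + 0))) /=.
  by rewrite !(addr0, add0r); congr (_, _); rewrite addrC.
by apply: (Plin _ _ _ (PD a b)); exact: (Plin _ _ _ (PE c d)).
Qed.

Lemma calL_spanZ k M : lin_span calL_gens M -> lin_span calL_gens (k *: M).
Proof. by move=> hM; rewrite -[_ *: _]addr0; apply: lin_span_lin => //; exact: lin_span0. Qed.
Lemma calL_spanN M : lin_span calL_gens M -> lin_span calL_gens (- M).
Proof. by rewrite -scaleN1r; exact: calL_spanZ. Qed.
Lemma calL_spanD M N : lin_span calL_gens M -> lin_span calL_gens N ->
  lin_span calL_gens (M + N).
Proof. by rewrite -{2}[M]scale1r; exact: lin_span_lin. Qed.

Lemma fkts_LLE u v x y z : S u v (S x y z) - S x y (S u v z) =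
  S (S u v x) y z + eps *: S x (S v u y) z.
Proof. exact: (congr1 (fun f => f z) (fkts_LL S u v x y)). Qed.

Lemma fkts_KKE u v x y z : K (K u v x) y z = S y x (K u v z) - eps *: K u v (S x y z).
Proof. exact: (congr1 (fun f => f z) (fkts_KK S u v x y)). Qed.

Lemma opKZ x y k z : K x y (k *: z) = k *: K x y z.
Proof. by rewrite -[k *: z]addr0 opK_linear !opKE !tprodE !scaler0 subrr addr0. Qed.
Lemma opK0 u v : K u v 0 = 0.
Proof. by rewrite opKE !tprodE scaler0 subrr. Qed.
Lemma opKB x y z z' : K x y (z - z') = K x y z - K x y z'.
Proof. by rewrite -scaleN1r addrC opK_linear scaleN1r addrC. Qed.

Lemma opLE x y z : L x y z = S x y z. Proof. by []. Qed.

Lemma opK_opK u v x w y : K u v (K x w y) =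
  eps *: (delta *: S (K u v w) x y - S (K u v x) w y).
Proof.
have e1 : eps *: K u v (S x y w) =
    S y x (K u v w) - (S (K u v x) w y - delta *: S y w (K u v x)).
  by have := fkts_KKE u v x y w; rewrite opKE => ->; rewrite subKr.
have e2 : eps *: K u v (S w y x) =
    S y w (K u v x) - (S (K u v w) x y - delta *: S y x (K u v w)).
  by have := fkts_KKE u v w y x; rewrite opKE => ->; rewrite subKr.
rewrite -[LHS]scale1r -fkts_eps2 -scalerA; congr (_ *: _).
rewrite [K x w y]opKE opKB opKZ scalerBr scalerA [eps * delta]mulrC -scalerA e1 e2.
rewrite !scalerBr scalerA fkts_delta2 scale1r !opprB addrACA [_ + (_ - S y x _)]addrC.
by rewrite subrK [_ - _ - _]addrAC subrr add0r.
Qed.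

Lemma opL_opK u v x y z :
  S (K u x v) y z - delta *: S (K u x y) v z =
  eps *: (delta *: S u (K v y x) z - S x (K v y u) z).
Proof.
have I1 : S (S u v x) y z + eps *: S x (S v u y) z
          + (S (S x y u) v z + eps *: S u (S y x v) z) = 0.
  by rewrite -fkts_LLE -fkts_LLE addrA subrK subrr.
have I2 : S (S x v u) y z + eps *: S u (S v x y) z
          + (S (S u y x) v z + eps *: S x (S y u v) z) = 0.
  by rewrite -fkts_LLE -fkts_LLE addrA subrK subrr.
apply/eqP; rewrite -subr_eq0; apply/eqP.
transitivity (0 - delta *: (0 : U)); last by rewrite scaler0 subr0.
rewrite -{1}I1 -I2 !opKE !tprodE !(scalerBr, scalerDr, scalerN, opprB, opprD, opprK).
rewrite !scalerA mulrAC fkts_delta2 ?mul1r ?scale1r -?mulrA ?fkts_delta2 ?mulr1.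
rewrite ?scale1r [delta * eps]mulrC ?addrA.
by rewrite [LHS](ACl (1*5*3*7*2*8*4*6))%AC.
Qed.

Lemma mx2_ext (A B C D A' B' C' D' : U -> U) :
  A =1 A' -> B =1 B' -> C =1 C' -> D =1 D' -> mx2 A B C D = mx2 A' B' C' D'.
Proof. by move=> /funext-> /funext-> /funext-> /funext->. Qed.

Lemma mx2M (A B C D A' B' C' D' : U -> U) :
  linear A -> linear B -> linear C -> linear D ->
  mx2 A B C D \o mx2 A' B' C' D' =
  mx2 ((A \o A') + (B \o C')) ((A \o B') + (B \o D'))
      ((C \o A') + (D \o C')) ((C \o B') + (D \o D')).
Proof.
have add (f : U -> U) x y : linear f -> f (x + y) = f x + f y.
  by move=> hf; have := hf 1 x y; rewrite !scale1r.
move=> hA hB hC hD; apply/funext => -[x y]; rewrite /mx2 !fctE /=.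
by rewrite (add A) // (add B) // (add C) // (add D) //; congr (_, _); rewrite addrACA.
Qed.
Lemma mx2D (A B C D A' B' C' D' : U -> U) :
  mx2 A B C D + mx2 A' B' C' D' = mx2 (A + A') (B + B') (C + C') (D + D').
Proof.
by apply/funext => -[x y]; congr (_, _); rewrite /= !fctE addrACA.
Qed.
Lemma mx2Z k (A B C D : U -> U) :
  k *: mx2 A B C D = mx2 (k *: A) (k *: B) (k *: C) (k *: D).
Proof.
by apply/funext => -[x y]; congr (_, _); rewrite /= !fctE scalerDr.
Qed.
Lemma mx2N (A B C D : U -> U) : - mx2 A B C D = mx2 (- A) (- B) (- C) (- D).
Proof. by rewrite -scaleN1r mx2Z !scaleN1r. Qed.

Lemma fct0E (k : U) : (0 : U -> U) k = 0. Proof. by []. Qed.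
Lemma lin_fct0 : linear (0 : U -> U).
Proof. by move=> k x y; rewrite !fct0E scaler0 addr0. Qed.
Lemma opL_linear a b : linear (L a b).
Proof. by move=> k x y; rewrite /opL !tprodE. Qed.
Lemma scale_opL_linear k a b : linear (k *: L a b).
Proof. by move=> c x y; rewrite !fctE opL_linear scalerDr !scalerA mulrC. Qed.

Lemma opK_lin a b : linear (K a b). Proof. exact: opK_linear. Qed.

#[local] Hint Resolve lin_fct0 opL_linear scale_opL_linear opK_lin : core.
#[local] Hint Resolve diag_op_in upper_op_in lower_op_in : core.

Definition op_simp := (fct0E, opLE, addr0, add0r, oppr0, subr0, scaler0).

Lemma comm_diag_diag a b c d :
  comm_op (diag_op a b) (diag_op c d) = diag_op (S a b c) d + eps *: diag_op c (S b a d).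
Proof.
rewrite /comm_op /diag_op !mx2M // mx2N mx2Z !mx2D.
apply: mx2_ext => z; rewrite !fctE ?op_simp ?tprod0r ?op_simp ?subrr //.
  exact: fkts_LLE.
rewrite !tprodE !scalerA fkts_eps2 !scale1r fkts_LLE.
by rewrite addrC.
Qed.

Lemma comm_diag_upper a b c d : comm_op (diag_op a b) (upper_op c d) = upper_op (K c d b) a.
Proof.
rewrite /comm_op /diag_op /upper_op !mx2M // mx2N !mx2D.
apply: mx2_ext => z; rewrite !fctE ?op_simp ?tprod0r ?opK0 ?op_simp ?subrr //.
by rewrite fkts_KKE opKZ.
Qed.

Lemma comm_diag_lower a b e f : comm_op (diag_op a b) (lower_op e f) = eps *: lower_op (K e f a) b.
Proof.
rewrite /comm_op /diag_op /lower_op !mx2M // mx2N mx2Z !mx2D.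
apply: mx2_ext => z; rewrite !fctE ?op_simp ?tprod0r ?opK0 ?op_simp ?subrr //.
by rewrite fkts_KKE scalerBr scalerA fkts_eps2 scale1r.
Qed.

Lemma comm_upper_upper c d c' d' : comm_op (upper_op c d) (upper_op c' d') = 0.
Proof.
rewrite /comm_op /upper_op !mx2M // mx2N !mx2D; apply/funext => -[x y].
by rewrite /mx2 !fctE ?op_simp ?opK0 ?op_simp ?subrr.
Qed.

Lemma comm_lower_lower c d c' d' : comm_op (lower_op c d) (lower_op c' d') = 0.
Proof.
rewrite /comm_op /lower_op !mx2M // mx2N !mx2D; apply/funext => -[x y].
by rewrite /mx2 !fctE ?op_simp ?opK0 ?op_simp ?subrr.
Qed.

Lemma comm_upper_lower c d e f : comm_op (upper_op c d) (lower_op e f) =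
  (eps * delta) *: diag_op (K c d f) e - eps *: diag_op (K c d e) f.
Proof.
rewrite /comm_op /upper_op /lower_op /diag_op !mx2M // !mx2Z !mx2N !mx2D.
apply: mx2_ext => z; rewrite !fctE ?op_simp ?tprod0r ?opK0 ?op_simp ?subrr //.
  by rewrite opK_opK scalerBr scalerA.
by rewrite opK_opK -scalerN opprB opL_opK !scalerA mulrAC fkts_eps2 mul1r !scale1r.
Qed.

Lemma comm_op_in M N : M \in calL_pred -> N \in calL_pred ->
  comm_op M N \in calL_pred.
Proof.
move=> hM hN; apply/calLP.
have lin0T : linear (0 : T -> T).
  by move=> k x y; rewrite -[LHS]/(0 : T) -[RHS]/(k *: (0 : T) + 0) scaler0 addr0.
have linT P : lin_span calL_gens P -> linear P.
  by move=> hP; exact: (@calL_linear (CalL (introT (calLP P) hP))).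
have comm0 (P : T -> T) : linear P -> comm_op 0 P = 0.
  by move=> hP; have := @comm_op_lin _ (-1) 0 0 P hP; rewrite scaler0 addr0 scaleN1r addNr.
pose good N := forall M, lin_span calL_gens M -> lin_span calL_gens (comm_op M N).
have goodlin k P Q : lin_span calL_gens P -> lin_span calL_gens Q ->
    good P -> good Q -> good (k *: P + Q).
  move=> hP hQ gP gQ R hR; rewrite comm_opC comm_op_lin; last exact: linT.
  rewrite opprD -scalerN -!comm_opC; exact: lin_span_lin (gP _ hR) (gQ _ hR).
suff H P : lin_span calL_gens P -> lin_span calL_gens P /\ good P.
  by apply: (H N (elimT (calLP N) hN)).2; apply/calLP.
move: P; apply: (calL_ind (P := fun P => lin_span calL_gens P /\ good P))
  => [|k P Q [hP gP] [hQ gQ]|a b|c d|e f].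
- split; first exact: lin_span0.
  by move=> P hP; rewrite comm_opC comm0 ?oppr0; [exact: lin_span0|exact: linT].
- split; [exact: lin_span_lin|exact: goodlin].
- split=> //; apply: (calL_ind (P := fun P =>
    lin_span calL_gens (comm_op P (diag_op a b)))) => [|k Q R hQ hR|a' b'|c' d'|e' f'].
  + rewrite comm0; [exact: lin_span0|exact: linT].
  + by rewrite comm_op_lin; [exact: lin_span_lin|exact: linT].
  + by rewrite comm_diag_diag; apply: calL_spanD => //; exact: calL_spanZ.
  + by rewrite comm_opC comm_diag_upper; exact: calL_spanN.
  + by rewrite comm_opC comm_diag_lower; apply: calL_spanN; exact: calL_spanZ.
- split=> //; apply: (calL_ind (P := fun P =>
    lin_span calL_gens (comm_op P (upper_op c d)))) => [|k Q R hQ hR|a' b'|c' d'|e' f'].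
  + rewrite comm0; [exact: lin_span0|exact: linT].
  + by rewrite comm_op_lin; [exact: lin_span_lin|exact: linT].
  + by rewrite comm_diag_upper.
  + by rewrite comm_upper_upper; exact: lin_span0.
  + by rewrite comm_opC comm_upper_lower; apply: calL_spanN; apply: calL_spanD;
      [exact: calL_spanZ|apply: calL_spanN; exact: calL_spanZ].
- split=> //; apply: (calL_ind (P := fun P =>
    lin_span calL_gens (comm_op P (lower_op e f)))) => [|k Q R hQ hR|a' b'|c' d'|e' f'].
  + rewrite comm0; [exact: lin_span0|exact: linT].
  + by rewrite comm_op_lin; [exact: lin_span_lin|exact: linT].
  + by rewrite comm_diag_lower; exact: calL_spanZ.
  + by rewrite comm_upper_lower; apply: calL_spanD; [exact: calL_spanZ|apply: calL_spanN; exact: calL_spanZ].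
  + by rewrite comm_lower_lower; exact: lin_span0.
Qed.

Definition mxTT (X Y : T) : T -> T :=
  mx2 (L X.1 Y.2 - delta *: L Y.1 X.2) (delta *: K X.1 Y.1)
      (- (eps *: K X.2 Y.2)) (eps *: L Y.2 X.1 - (eps * delta) *: L X.2 Y.1).

Lemma mxTT_in X Y : mxTT X Y \in calL_pred.
Proof.
apply/calLP; have -> : mxTT X Y = diag_op X.1 Y.2 + ((- delta) *: diag_op Y.1 X.2 +
    (delta *: upper_op X.1 Y.1 + (- eps) *: lower_op X.2 Y.2)).
  rewrite /diag_op /upper_op /lower_op !mx2Z !mx2D.
  by apply: mx2_ext => z;
    rewrite !fctE ?op_simp ?scaleNr ?scalerA ?[delta * eps]mulrC.
by apply: calL_spanD => //; apply: calL_spanD; [|apply: calL_spanD]; exact: calL_spanZ.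
Qed.

(* The underlying space of g(U) = calL + T; the even (resp. odd) part consists
   of the pairs whose second (resp. first) component is 0. *)
Definition gU : Type := (calL * T)%type.

HB.instance Definition _ := GRing.Lmodule.on gU.

(* For M in calL and X in T, [X, M] = - M(X) both in the Lie case and in the
   super case, since M is even. *)
Definition bracket (X Y : gU) : gU :=
  (CalL (comm_op_in (calL_valP X.1) (calL_valP Y.1)) + CalL (mxTT_in X.2 Y.2),
   X.1 Y.2 - Y.1 X.2).

Definition is_even (X : gU) : Prop := X.2 = 0.
Definition is_odd (X : gU) : Prop := X.1 = 0.

(* Automorphisms of the Lie algebra (delta = 1) or Lie superalgebra
   (delta = -1); superalgebra automorphisms also preserve parity. *)
Definition is_aut (f : gU -> gU) : Prop :=
  [/\ linear f, bijective f,
      forall X Y, f (bracket X Y) = bracket (f X) (f Y)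
    & delta = -1 -> (forall X, is_even X -> is_even (f X)) /\
                    (forall X, is_odd X -> is_odd (f X))].

Definition component (i : int) : set gU :=
  match i with
  | Posz 0 => [set X : gU | X.2 = 0 /\
      lin_span [set M : T -> T | exists a b, M = mx2 (L a b) 0 0 (eps *: L b a)] (calL_val X.1)]
  | Posz 1 => [set X : gU | X.1 = 0 /\ X.2.2 = 0]
  | Negz 0 => [set X : gU | X.1 = 0 /\ X.2.1 = 0]
  | Posz 2 => [set X : gU | X.2 = 0 /\
      lin_span [set M : T -> T | exists a b, M = mx2 0 (K a b) 0 0] (calL_val X.1)]
  | Negz 1 => [set X : gU | X.2 = 0 /\
      lin_span [set M : T -> T | exists a b, M = mx2 0 0 (K a b) 0] (calL_val X.1)]
  | _ => [set 0]
  end.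

Definition weight_map (w : F) (phi : gU -> gU) : Prop :=
  forall i : int, -2 <= i <= 2 -> forall X, component i X -> phi X = w ^ i *: X.

Definition thetaT (X : T) : T := (- (eps *: X.2), delta *: X.1).
Definition thetaTinv (X : T) : T := (delta *: X.2, - (eps *: X.1)).

Lemma thetaTK : cancel thetaT thetaTinv.
Proof.
by case=> x y; rewrite /thetaTinv /= scalerN !scalerA fkts_eps2 fkts_delta2 !scale1r opprK.
Qed.

Lemma thetaTinvK : cancel thetaTinv thetaT.
Proof.
by case=> x y; rewrite /thetaT /= scalerN !scalerA fkts_eps2 fkts_delta2 !scale1r opprK.
Qed.

Lemma conj_op_lin (f g : T -> T) k (M N : T -> T) : linear f ->
  f \o (k *: M + N) \o g = k *: (f \o M \o g) + (f \o N \o g).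
Proof. by move=> hf; apply/funext => x; rewrite !fctE hf. Qed.

Lemma conj_op0 (f g : T -> T) : linear f -> f \o (0 : T -> T) \o g = 0.
Proof.
move=> hf; have := conj_op_lin g (-1) 0 0 hf.
by rewrite scaler0 addr0 scaleN1r addNr.
Qed.

Lemma thetaT_linear : linear thetaT.
Proof.
move=> k [x y] [x' y']; congr (_, _) => /=.
  by rewrite scalerDr opprD scalerN !scalerA mulrC.
by rewrite scalerDr !scalerA mulrC.
Qed.

Lemma theta_conj_in (M : T -> T) : M \in calL_pred ->
  thetaT \o M \o thetaTinv \in calL_pred.
Proof.
move=> /calLP hM; apply/calLP; move: M hM.
apply: (calL_ind (P := fun M => lin_span calL_gens (thetaT \o M \o thetaTinv)))
  => [|k M N hM hN|a b|c d|e f].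
- rewrite conj_op0; [exact: lin_span0|exact: thetaT_linear].
- by rewrite conj_op_lin; [exact: lin_span_lin|exact: thetaT_linear].
- have -> : thetaT \o diag_op a b \o thetaTinv = eps *: diag_op b a.
    rewrite /diag_op mx2Z; apply/funext => -[x y]; rewrite /mx2 /thetaT /= !fctE.
    rewrite !op_simp !tprodE !scalerN !opprK !scalerA fkts_eps2 !scale1r.
    by rewrite mul1r fkts_delta2 scale1r.
  exact: calL_spanZ.
- have -> : thetaT \o upper_op c d \o thetaTinv = (- (eps * delta)) *: lower_op c d.
    rewrite /lower_op mx2Z; apply/funext => -[x y]; rewrite /mx2 /thetaT /= !fctE.
    by rewrite !op_simp -scaleN1r !opKZ !scalerA mulN1r mulrN [delta * eps]mulrC.
  exact: calL_spanZ.
have -> : thetaT \o lower_op e f \o thetaTinv = (- (eps * delta)) *: upper_op e f.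
  rewrite /upper_op mx2Z; apply/funext => -[x y]; rewrite /mx2 /thetaT /= !fctE.
  by rewrite !op_simp opKZ scalerA scaleNr.
exact: calL_spanZ.
Qed.

Definition theta (X : gU) : gU :=
  (CalL (theta_conj_in (calL_valP X.1)), thetaT X.2).

Lemma theta_linear : linear theta.
Proof.
move=> k X Y; congr (_, _); last exact: thetaT_linear.
by apply: val_inj => /=; apply: conj_op_lin; exact: thetaT_linear.
Qed.

HB.instance Definition _ := GRing.isLinear.Build F gU gU *:%R theta theta_linear.

(* g(U) is the sum of the components of weight -2..2, so weight_map determines
   phi. *)
Lemma weight_map_exists (w : F) : w ^+ 3 = 1 ->
  exists phi : {linear gU -> gU}, weight_map w phi.
Proof.
move=> w3.
have w4 : w ^+ 2 * w ^+ 2 = w by rewrite -exprD exprS w3 mulr1.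
have w12 : w * w ^+ 2 = 1 by rewrite -exprS.
have w0 : w != 0.
  by apply/eqP => w0; move: w12 => /eqP; rewrite w0 mul0r eq_sym oner_eq0.
have wV : w ^-1 = w ^+ 2.
  by apply: (mulfI w0); rewrite mulfV.
pose D (X : T) : T := (w *: X.1, w ^+ 2 *: X.2).
pose D' (X : T) : T := (w ^+ 2 *: X.1, w *: X.2).
have linD : linear D.
  by move=> k [x y] [x' y'];
    congr (_, _); rewrite /= scalerDr !scalerA mulrC.
have DD a b : D \o diag_op a b \o D' = diag_op a b.
  apply/funext => -[x y]; rewrite /diag_op /mx2 /D /= !fctE !op_simp !tprodE !scalerA.
  by rewrite w12 scale1r mulrCA [w ^+ 2 * w]mulrC w12 mulr1.
have DE c d : D \o upper_op c d \o D' = w ^+ 2 *: upper_op c d.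
  rewrite /upper_op mx2Z; apply/funext => -[x y]; rewrite /mx2 /D /= !fctE.
  by rewrite !op_simp opKZ scalerA -expr2.
have DF c d : D \o lower_op c d \o D' = w *: lower_op c d.
  rewrite /lower_op mx2Z; apply/funext => -[x y]; rewrite /mx2 /D /= !fctE.
  by rewrite !op_simp opKZ scalerA w4.
have D_in M : M \in calL_pred -> D \o M \o D' \in calL_pred.
  move=> /calLP hM; apply/calLP; move: M hM.
  apply: (calL_ind (P := fun M => lin_span calL_gens (D \o M \o D')))
    => [|k M N hM hN|a b|c d|e f].
  - by rewrite conj_op0 //; exact: lin_span0.
  - by rewrite conj_op_lin //; exact: lin_span_lin.
  - by rewrite DD.
  - by rewrite DE; exact: calL_spanZ.
  by rewrite DF; exact: calL_spanZ.
pose phi (X : gU) : gU := (CalL (D_in _ (calL_valP X.1)), D X.2).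
have phi_lin : linear phi.
  move=> k X Y; congr (_, _); last exact: linD.
  by apply: val_inj => /=; exact: conj_op_lin.
pose phiL := GRing.isLinear.Build F gU gU *:%R phi phi_lin.
pose Phi : {linear gU -> gU} := HB.pack phi phiL.
have span_eig (A : set (T -> T)) k M : (forall N, A N -> D \o N \o D' = k *: N) ->
    lin_span A M -> D \o M \o D' = k *: M.
  move=> hA; move: M; apply: lin_span_ind => //.
  - by rewrite conj_op0 // scaler0.
  - by move=> c M N hM hN; rewrite conj_op_lin // hM hN scalerDr !scalerA mulrC.
exists Phi => i hi [M [x y]] hX; rewrite -[Phi _]/(phi _).
have pairE (k : F) : D \o M \o D' = k *: (M : T -> T) -> D (x, y) = k *: (x, y) ->
    phi (M, (x, y)) = k *: ((M, (x, y)) : gU).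
  by move=> hM hx; congr (_, _) => //; apply: val_inj.
have D0 : D 0 = 0 by rewrite /D /= !scaler0.
case: i hi hX => [[|[|[|n]]]|[|[|n]]] //= _.
- move=> [xy0 hM]; rewrite expr0z; apply: pairE; last by rewrite xy0 D0 scaler0.
  by apply: span_eig hM => _ [a [b ->]]; rewrite scale1r; exact: DD.
- move=> [M0 y0]; rewrite expr1z; apply: pairE; first by rewrite M0 conj_op0 // scaler0.
  by rewrite /D /= y0 !scaler0 /=; congr (_, _); rewrite scaler0.
- move=> [xy0 hM]; rewrite -exprnP; apply: pairE; last by rewrite xy0 D0 scaler0.
  by apply: span_eig hM => _ [a [b ->]]; exact: DE.
- move=> [M0 x0]; rewrite NegzE exprN1 wV; apply: pairE.
    by rewrite M0 conj_op0 // scaler0.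
  by rewrite /D /= x0 !scaler0 /=; congr (_, _); rewrite scaler0.
- move=> [xy0 hM]; rewrite NegzE -exprnN -exprVn wV -exprM.
  rewrite (_ : w ^+ (2 * 2) = w); last by rewrite exprM -[RHS]w4 expr2.
  apply: pairE; last by rewrite xy0 D0 scaler0.
  by apply: span_eig hM => _ [a [b ->]]; exact: DF.
Qed.

(* A left action by automorphisms, i.e. a homomorphism gT -> Aut(g(U)); the
   library's {action gT &-> _} are right actions. *)
Definition left_aut_action (gT : finGroupType) (rho : gT -> gU -> gU) : Prop :=
  [/\ rho 1%g =1 id, forall a b, rho (a * b)%g =1 rho a \o rho b
    & forall a, is_aut (rho a)].

End StandardEmbedding.

(* gT is the group presented by <s, t : s^4 = 1 = t^3, t s t = s>: the first
   clause only provides some generators satisfying the relations; since gT is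
   finite, any other generators satisfying them serve equally. *)
Definition Dic3_presented (gT : finGroupType) (s t : gT) : Prop :=
  [/\ [set: gT] \isog Grp (x : y : x ^+ 4, y ^+ 3, y * x * y = x),
      <<[set s; t]>> = [set: gT], s ^+ 4 = 1, t ^+ 3 = 1 & t * s * t = s]%g.

(* Main.v *)
Require Import Defs.
From HB Require Import structures.
From mathcomp Require Import all_boot all_order all_algebra.
From mathcomp Require Import all_fingroup all_solvable.
From mathcomp Require Import boolp functions ring.
Import GRing.Theory.

Set Implicit Arguments.
Unset Strict Implicit.
Unset Printing Implicit Defensive.

(** Each of the maps [theta] and [phi] of g(U) = L + T comes from an invertible
    linear map D of T: it is D on T and conjugation M |-> D M D^-1 on L
    ([conj_extension]).  For [theta] this is the definition; for [phi] the map D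
    is (x ; y) |-> (w x ; w^2 y), since w^2 = w^-1, and [weight_map_extension]
    checks it on generators.  Such an extension is determined by D, and the
    extensions compose, so every relation between [theta] and [phi] is a
    relation between 2 x 2 matrices acting on T: theta^2 = - eps delta, the
    dilation D = diag(w, w^2) has cube 1, and D theta D = theta because theta
    exchanges the two coordinates while D scales them by mutually inverse
    factors.

    Conjugation by D respects the commutator of L and the action of L on T for
    free.  Hence such an extension is an automorphism as soon as D is compatible
    with the bracket T x T -> L ([conj_extension_aut]), a short computation for
    both maps ([mxTT_theta], [mxTT_dil]).

    For the group action, a presentation in the sense of finite groups only
    speaks of finite images, whereas all automorphisms of g(U) may form an
    infinite group.  So the universal property of Dic_3 is proved for arbitrary monoids
    ([Dic3_lift]): every element is t^i s^j with i mod 3 and j mod 4 unique,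
    and words in this form multiply by the same rule wherever the relations
    hold.  Uniqueness amounts to the order being 12, for which one finite group
    generated by such a pair is enough; inside S_3 x Z/4 the elements
    (transposition, 1) and (3-cycle, 0) have orders 4 and 3.  When
    delta = - eps, theta^2 = 1, so the action is trivial on <s^2>, which is the
    kernel of the projection of Dic_3 onto S_3, and it descends. *)

(** * The dicyclic group of order 12 *)

Section DicyclicWords.
Local Open Scope group_scope.
Variables (M : monoidType) (a b : M).
Hypotheses (a4 : a ^+ 4 = 1) (b3 : b ^+ 3 = 1) (bab : b * a * b = a).

Lemma Dic3_swap : a * b = b ^+ 2 * a.
Proof. by rewrite -[in RHS]bab !mulgA -expgSr b3 mul1g. Qed.

(** In the relation a b = b^2 a the exponent 2 plays the role of -1 modulo 3;
    with a nonnegative exponent the rule makes sense in a monoid. *)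
Lemma Dic3_swapX j k : a ^+ j * b ^+ k = b ^+ (k * 2 ^ j) * a ^+ j.
Proof.
have swap1 n : a * b ^+ n = b ^+ (n * 2) * a.
  elim: n => [|n IH]; first by rewrite !expg0 mulg1 mul1g.
  by rewrite expgS mulgA Dic3_swap -mulgA IH mulgA -expgnDr -mulSn.
elim: j k => [|j IH] k; first by rewrite expg0 muln1 mulg1 mul1g.
rewrite expgSr -mulgA swap1 mulgA IH -mulgA -expgSr; congr (b ^+ _ * _).
by rewrite -mulnA -expnS.
Qed.

(** The product of two normal forms is computed from the relations alone, hence
    by the same formula in Dic_3 and in any monoid where they hold. *)
Lemma Dic3_mul i j k l : b ^+ i * a ^+ j * (b ^+ k * a ^+ l) =
  b ^+ (i + k * 2 ^ j) * a ^+ (j + l).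
Proof.
by rewrite -mulgA (mulgA (a ^+ j)) Dic3_swapX !expgnDr !mulgA.
Qed.

End DicyclicWords.

Section ThreePoints.
Local Open Scope group_scope.

Definition tau3 : 'S_3 := @tperm 'I_3 0%R 1%R.
Definition sig3 : 'S_3 := @tperm 'I_3 0%R 1%R * @tperm 'I_3 1%R 2%R.

Lemma order_tau3 : #[tau3] = 2.
Proof.
apply: nt_prime_order => //; first exact: tperm2.
by apply/eqP => /permP /(_ 0%R); rewrite tpermL perm1.
Qed.

Lemma order_sig3 : #[sig3] = 3.
Proof.
apply: nt_prime_order => //; last first.
  by apply/eqP => /permP /(_ 1%R); rewrite permM tpermR perm1 tpermD.
apply/permP => -[[|[|[|m]]] hm] //; rewrite !expgS expg0 !permM !perm1 !permE /=;
  by apply: val_inj.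
Qed.

Lemma sig3_tau3_sig3 : sig3 * tau3 * sig3 = tau3.
Proof.
have mul_invol (gT : finGroupType) (x y : gT) :
    x * x = 1 -> y * y = 1 -> x * y * x * (x * y) = x.
  by move=> x2 y2; rewrite -!mulgA (mulgA x x) x2 mul1g y2 mulg1.
by apply: mul_invol; exact: tperm2.
Qed.

End ThreePoints.

Section Dic3Group.
Local Open Scope group_scope.
Variables (gT : finGroupType) (s t : gT).
Hypothesis pres : Dic3_presented s t.

(** The defining property of the finite presentation, with the generated group
    in place of an arbitrary one. *)
Lemma Dic3_homg (hT : finGroupType) (a b : hT) :
  a ^+ 4 = 1 -> b ^+ 3 = 1 -> b * a * b = a ->
  <<[set a; b]>> \homg [set: gT].
Proof.
case: pres => [presG _ _ _ _] a4 b3 bab.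
rewrite -[[set: gT]]/(gval [set: gT]%G) presG; apply/existsP; exists (a, b).
by rewrite /= !xpair_eqE a4 b3 bab !eqxx joing_idl joing_idr eqxx.
Qed.

(** The only place where Dic_3 must be shown not to collapse.  Any quotient
    generated by elements of orders 4 and 3 does it: here one inside
    S_3 x Z/4, the transposition alone having order 2 only. *)
Lemma Dic3_card_dvd12 : (12 %| #|gT|)%N.
Proof.
pose a : 'S_3 * 'Z_4 := (tau3, Zp1); pose b : 'S_3 * 'Z_4 := (sig3, 1).
have pairX (x : 'S_3 * 'Z_4) n : x ^+ n = (x.1 ^+ n, x.2 ^+ n).
  by elim: n => // n IH; rewrite !expgS IH.
have oa : #[a] = 4.
  apply: (@orderXpfactor _ 2 1 2 a) => //; apply: nt_prime_order => //.
    rewrite -expgM pairX; congr pair; last exact: val_inj.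
    by apply/eqP; rewrite -order_dvdn order_tau3.
  by rewrite pairX xpair_eqE negb_and orbC.
have ob : #[b] = 3.
  apply: nt_prime_order => //.
    by rewrite pairX expg1n; congr pair; apply/eqP; rewrite -order_dvdn order_sig3.
  by apply/eqP=> -[/eqP]; rewrite -order_eq1 order_sig3.
have bab : b * a * b = a.
  by congr pair; [exact: sig3_tau3_sig3 | exact: val_inj].
have homH : <<[set a; b]>> \homg [set: gT].
  by apply: Dic3_homg => //; apply/eqP; rewrite -order_dvdn ?oa ?ob.
have dvdH x : x \in [set a; b] -> (#[x] %| #|gT|)%N.
  move=> abx; rewrite -cardsT; apply: dvdn_trans (card_homg homH).
  by rewrite order_dvdG // mem_gen.
rewrite (Gauss_dvd _ (_ : coprime 4 3)) //; apply/andP; split.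
  by rewrite -oa dvdH // !inE eqxx.
by rewrite -ob dvdH // !inE eqxx orbT.
Qed.

(** The relations make <[t]> normal. *)
Lemma Dic3_prod : <[t]> * <[s]> = [set: gT].
Proof.
case: pres => _ gen _ t3 tst.
have nts : <[s]> \subset 'N(<[t]>).
  rewrite cycle_subG -groupV inE -cycleJ cycle_subG.
  rewrite conjgE invgK mulgA (Dic3_swap t3 tst).
  by rewrite mulgK groupX // cycle_id.
by rewrite -norm_joinEr // joingC joing_idl joing_idr; exact: gen.
Qed.

Lemma Dic3_word g : exists ij, g = t ^+ ij.1 * s ^+ ij.2.
Proof.
have: g \in <[t]> * <[s]> by rewrite Dic3_prod inE.
by case/mulsgP => _ _ /cycleP[i ->] /cycleP[j ->] ->; exists (i, j).
Qed.

(** The orders of s and t divide 4 and 3, and their product is a multiple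
    of 12. *)
Lemma Dic3_orders : [/\ #|gT| = 12, #[s] = 4, #[t] = 3 & <[t]> :&: <[s]> = 1].
Proof.
case: (pres) => _ _ s4 t3 _.
have ds : (#[s] %| 4)%N by rewrite order_dvdn s4.
have dt : (#[t] %| 3)%N by rewrite order_dvdn t3.
have co : coprime #[t] #[s].
  by apply: coprime_dvdl dt _; apply: coprime_dvdr ds _.
have TI : <[t]> :&: <[s]> = 1 by apply: coprime_TIg.
have := mul_cardG <[t]> <[s]>; rewrite TI cards1 Dic3_prod cardsT muln1 => cardG.
have c12 : (12 %| #[t] * #[s])%N by rewrite cardG Dic3_card_dvd12.
have s_eq : #[s] = 4.
  apply/eqP; rewrite eqn_dvd ds -(Gauss_dvdr _ (_ : coprime 4 #[t])).
    by rewrite (dvdn_trans _ c12).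
  exact: coprime_dvdr dt _.
have t_eq : #[t] = 3.
  apply/eqP; rewrite eqn_dvd dt -(Gauss_dvdl _ (_ : coprime 3 #[s])).
    by rewrite (dvdn_trans _ c12).
  exact: coprime_dvdr ds _.
by split=> //; rewrite -cardG; exact: (congr2 muln t_eq s_eq).
Qed.

Lemma Dic3_word_inj i j k l : t ^+ i * s ^+ j = t ^+ k * s ^+ l ->
  i = k %[mod 3] /\ j = l %[mod 4].
Proof.
have [_ os ot TI] := Dic3_orders => eqw.
have tik : (t ^+ k)^-1 * t ^+ i = s ^+ l * (s ^+ j)^-1.
  by apply: (mulIg (s ^+ j)); rewrite -mulgA eqw mulKg mulgKV.
have : (t ^+ k)^-1 * t ^+ i \in <[t]> :&: <[s]>.
  by rewrite inE {2}tik !(groupM, groupV, groupX, cycle_id).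
rewrite TI inE => /eqP tik1.
have ti : t ^+ i = t ^+ k by rewrite -[LHS](mulKVg (t ^+ k)) tik1 mulg1.
move: eqw; rewrite ti => /mulgI sj.
by split; apply/eqP; [rewrite -ot|rewrite -os]; rewrite -eq_expg_mod_order ?ti ?sj.
Qed.

(** The universal property of Dic_3 with values in an arbitrary monoid. *)
Lemma Dic3_lift (M : monoidType) (a b : M) :
  a ^+ 4 = 1 -> b ^+ 3 = 1 -> b * a * b = a ->
  exists f : gT -> M, {morph f : x y / x * y} /\
    forall i j, f (t ^+ i * s ^+ j) = b ^+ i * a ^+ j.
Proof.
case: (pres) => _ _ _ t3 tst a4 b3 bab.
have [word wordE] := choice Dic3_word.
have expm (x : M) n i j : x ^+ n = 1 -> i = j %[mod n] -> x ^+ i = x ^+ j.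
  move=> xn eij; rewrite (divn_eq i n) (divn_eq j n) eij !expgnDr.
  by rewrite ![(_ * n)%N]mulnC !expgM xn !expg1n.
pose f g := b ^+ (word g).1 * a ^+ (word g).2.
have fE i j : f (t ^+ i * s ^+ j) = b ^+ i * a ^+ j.
  have [ei ej] := Dic3_word_inj (wordE (t ^+ i * s ^+ j)).
  by rewrite /f (expm b 3 _ _ b3 ei) (expm a 4 _ _ a4 ej).
exists f; split=> // x y; case: (Dic3_word x) => -[i j] ->.
case: (Dic3_word y) => -[k l] -> /=.
by rewrite (Dic3_mul t3 tst) !fE (Dic3_mul b3 bab).
Qed.

End Dic3Group.

Section Dic3Quotient.
Local Open Scope group_scope.
Variables (gT : finGroupType) (s t : gT).
Hypothesis pres : Dic3_presented s t.

(** The projection s |-> transposition, t |-> 3-cycle.  It is onto because its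
    image has elements of orders 2 and 3; its kernel has order 12 / 6 and
    contains the element s^2 of order 2. *)
Lemma Dic3_onto_S3 : exists pi : {morphism [set: gT] >-> 'S_3},
  pi @* [set: gT] = [set: 'S_3] /\ 'ker pi = <[s ^+ 2]>.
Proof.
have [card12 os _ _] := Dic3_orders pres.
have a4 : tau3 ^+ 4 = 1 by apply/eqP; rewrite -order_dvdn order_tau3.
have b3 : sig3 ^+ 3 = 1 by apply/eqP; rewrite -order_dvdn order_sig3.
have [f [fM fE]] := Dic3_lift pres a4 b3 sig3_tau3_sig3.
pose pi := @Morphism _ _ [set: gT] f (fun x y _ _ => fM x y).
have dvd_im i j : #[pi (t ^+ i * s ^+ j)] %| #|pi @* [set: gT]|.
  by apply: order_dvdG; apply: mem_morphim; rewrite inE.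
have im_pi : pi @* [set: gT] = [set: 'S_3].
  apply/eqP; rewrite eqEcard subsetT cardsT card_Sn.
  apply: dvdn_leq; first exact: cardG_gt0.
  rewrite (Gauss_dvd _ (_ : coprime 2 3)) //; apply/andP; split.
    by have := dvd_im 0%N 1%N; rewrite /= fE mul1g order_tau3.
  by have := dvd_im 1%N 0%N; rewrite /= fE mulg1 order_sig3.
exists pi; split=> //; apply/esym/eqP; rewrite eqEcard; apply/andP; split.
  rewrite cycle_subG; apply/kerP; rewrite ?inE //=.
  have := fE 0%N 2%N; rewrite !expg0 !mul1g => ->.
  by apply/eqP; rewrite -order_dvdn order_tau3.
have := Lagrange (subsetT ('ker pi)).
have := card_morphim pi [set: gT]; rewrite im_pi setIid.
rewrite !cardsT card_Sn card12 => <- card_ker.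
have os2 : #[s ^+ 2] = 2 by rewrite orderXdiv os.
suff le2 : #|'ker pi| <= 2 by exact: leq_trans le2 (eq_leq (esym os2)).
by rewrite -(leq_pmul2r (_ : 0 < 3`!)) // card_ker.
Qed.

End Dic3Quotient.

(** * Morphisms to monoids and the monoid of self-maps *)

Section MonoidMorphisms.
Local Open Scope group_scope.

(** The first isomorphism theorem for morphisms to a monoid: the values at g and
    at a chosen preimage of pi g agree, since they differ by a factor in the
    kernel. *)
Lemma morph_descent (gT hT : finGroupType)
    (pi : {morphism [set: gT] >-> hT}) (M : monoidType) (f : gT -> M) :
  pi @* [set: gT] = [set: hT] -> {morph f : x y / x * y} ->
  {in 'ker pi, f =1 fun=> 1} ->
  exists f' : hT -> M, {morph f' : x y / x * y} /\ forall g, f g = f' (pi g).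
Proof.
move=> im_pi fM f_ker.
have piM : {morph pi : x y / x * y} by move=> x y; rewrite morphM ?in_setT.
have lift q : exists g, pi g = q.
  have /morphimP[g _ _ ->] : q \in pi @* [set: gT] by rewrite im_pi inE.
  by exists g.
have [sec secK] := choice lift.
have fE g : f g = f (sec (pi g)).
  have gE : g = sec (pi g) * ((sec (pi g))^-1 * g) by rewrite mulKVg.
  suff ker_g : (sec (pi g))^-1 * g \in 'ker pi.
    by rewrite [in LHS]gE fM (f_ker _ ker_g) mulg1.
  have piV1 : pi (sec (pi g))^-1 * pi g = 1.
    by rewrite morphV ?in_setT // secK mulVg.
  by apply/(kerP pi (in_setT _)); rewrite -[RHS]piV1; exact: piM.
exists (f \o sec); split=> // x y /=.
by rewrite -fM [in RHS]fE piM !secK.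
Qed.

(** An alias of X -> X, so that the composition monoid does not clash with the
    pointwise algebraic structures on functions. *)
Definition selfmap (X : Type) : Type := X -> X.

HB.instance Definition _ X := gen_eqMixin (selfmap X).
HB.instance Definition _ X := gen_choiceMixin (selfmap X).
HB.instance Definition _ X := @isMonoid.Build (selfmap X)
  (@comp X X X) id (fun f g h => erefl) (fun f => erefl) (fun f => erefl).

Lemma selfmap_exp X (f : selfmap X) n : f ^+ n = iter n f.
Proof. by elim: n => // n IH; rewrite expgS IH. Qed.

End MonoidMorphisms.

Local Open Scope ring_scope.

(** * Maps of g(U) induced by maps of T *)

Section Extension.
Variables (F : fieldType) (eps delta : F) (U : lmodType F).
Variable S : FKTS eps delta U.
Local Notation T := (U * U)%type.
Local Notation thT := (@thetaT F eps delta U).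
Local Notation thTinv := (@thetaTinv F eps delta U).
Local Notation th := (@theta F eps delta U S).

(** D' stands for the inverse of D; keeping it separate lets the relations be
    checked on D and D' without any invertibility argument. *)
Definition conj_extension (D D' : T -> T) (f : gU S -> gU S) : Prop :=
  forall X, calL_val (f X).1 = D \o calL_val X.1 \o D' /\ (f X).2 = D X.2.

Lemma conj_extension_id : conj_extension id id id.
Proof. by case. Qed.

Lemma conj_extension_comp D D' E E' f g :
  conj_extension D D' f -> conj_extension E E' g ->
  conj_extension (D \o E) (E' \o D') (f \o g).
Proof.
by move=> hf hg X /=; have [-> ->] := hf (g X); have [-> ->] := hg X.
Qed.

Lemma conj_extension_iter n D D' f :
  conj_extension D D' f -> conj_extension (iter n D) (iter n D') (iter n f).
Proof.
move=> hf; elim: n => [|n IH]; first exact: conj_extension_id.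
have -> : iter n.+1 D' = iter n D' \o D' by apply/funext => X; exact: iterSr.
exact: (conj_extension_comp hf IH).
Qed.

(** An extension is determined by D, so relations may be checked on T. *)
Lemma conj_extension_eq D D' E E' f g :
  conj_extension D D' f -> conj_extension E E' g ->
  D =1 E -> D' =1 E' -> f =1 g.
Proof.
move=> hf hg /funext eqD /funext eqD' X; have [f1 f2] := hf X.
have [g1 g2] := hg X; rewrite eqD eqD' -g1 in f1; rewrite eqD -g2 in f2.
by rewrite [f X]surjective_pairing [g X]surjective_pairing f2; congr pair; apply: val_inj.
Qed.

(** Of the three parts of the bracket, only T x T -> L imposes a condition on D.
    Bijectivity comes from finite order. *)
Lemma conj_extension_aut n (D D' : T -> T) f :
  linear D -> cancel D D' -> conj_extension D D' f -> iter n.+1 f =1 id ->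
  (forall X Y, mxTT S (D X) (D Y) = D \o mxTT S X Y \o D') -> is_aut f.
Proof.
move=> linD DK hf fn DTT.
have DD x y : D (x + y) = D x + D y by have := linD 1 x y; rewrite !scale1r.
have D0 : D 0 = 0 by apply: (addrI (D 0)); rewrite -DD !addr0.
have DN x : D (- x) = - D x.
  by apply: (addrI (D x)); rewrite -DD !subrr.
have eq_gU (X Y : gU S) : calL_val X.1 = calL_val Y.1 -> X.2 = Y.2 -> X = Y.
  by case: X Y => [X1 X2] [Y1 Y2] /= e1 e2; rewrite e2; congr pair; apply: val_inj.
split.
- move=> k X Y; have [e1 e2] := hf (k *: X + Y); have [x1 x2] := hf X.
  have [y1 y2] := hf Y; apply: eq_gU; last by rewrite e2 /= linD x2 y2.
  by rewrite e1 /= x1 y1 conj_op_lin.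
- by exists (iter n f) => X; rewrite -?iterSr ?fn // -[RHS]fn.
- move=> X Y; have [e1 e2] := hf (bracket X Y); have [x1 x2] := hf X.
  have [y1 y2] := hf Y; apply: eq_gU.
    rewrite e1 /= x1 x2 y1 y2 DTT; apply/funext => z.
    by rewrite /comm_op !fctE /= !DD DN !DK.
  by rewrite e2 /= DD DN x2 y2 x1 y1 /= !DK.
move=> _; split=> X; rewrite /is_even /is_odd => X0.
  by have [_ ->] := hf X; rewrite X0.
have [e1 _] := hf X; apply: val_inj; rewrite /= e1 X0.
by rewrite conj_op0.
Qed.

Lemma is_aut_id : is_aut (id : gU S -> gU S).
Proof. by split=> //; exists id. Qed.

Lemma is_aut_comp (f g : gU S -> gU S) : is_aut f -> is_aut g -> is_aut (f \o g).
Proof.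
move=> [lf bf mf pf] [lg bg mg pg]; split.
- by move=> k X Y /=; rewrite lg lf.
- exact: bij_comp.
- by move=> X Y /=; rewrite mg mf.
move=> sup; have [[ef of_] [eg og]] := (pf sup, pg sup).
by split=> X hX /=; [apply/ef/eg | apply/of_/og].
Qed.

Lemma is_aut_iter n (f : gU S -> gU S) : is_aut f -> is_aut (iter n f).
Proof.
move=> af; elim: n => [|n IH]; first exact: is_aut_id.
exact: (is_aut_comp af IH).
Qed.

(** * The automorphism theta *)

Lemma theta_extension : conj_extension thT thTinv th.
Proof. by []. Qed.

Lemma sign_scale (k : F) : k = 1 \/ k = -1 ->
  (forall v : U, k *: v = v) \/ (forall v : U, k *: v = - v).
Proof.
by case=> ->; [left; exact: scale1r | right; exact: scaleN1r].
Qed.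

(** Since eps and delta are signs, each of the four cases is an identity between
    signed sums of triple products. *)
Lemma mxTT_theta X Y : mxTT S (thT X) (thT Y) =
  thT \o mxTT S X Y \o thTinv.
Proof.
apply/funext => -[x y]; case: X Y => [a1 b1] [a2 b2].
rewrite /mxTT /thetaT /thetaTinv /mx2 /= !fctE /opL /opK /=.
have [e|e] := sign_scale (fkts_eps S); have [d|d] := sign_scale (fkts_delta S);
  rewrite -?scalerA !(e, d) !tprodE ?(opprD, opprK); congr pair; rewrite ?addrA;
  by [rewrite [LHS](ACl (3*4*2*1))%AC | rewrite [LHS](ACl (4*3*1*2))%AC].
Qed.

Lemma thetaT_sqr X : thT (thT X) = - (eps * delta) *: X.
Proof.
case: X => x y; rewrite /thetaT /=; congr pair => /=.
  by rewrite scalerA scaleNr.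
by rewrite scalerN scalerA mulrC scaleNr.
Qed.

Lemma thetaTinv_sqr X : thTinv (thTinv X) = - (eps * delta) *: X.
Proof.
case: X => x y; rewrite /thetaTinv /=; congr pair => /=.
  by rewrite scalerN scalerA mulrC scaleNr.
by rewrite scalerA scaleNr.
Qed.

Lemma theta_order4 : iter 4 th =1 id.
Proof.
have sgn2 X : - (eps * delta) *: (- (eps * delta) *: X) = X :> T.
  by rewrite scalerA mulrNN mulrACA (fkts_eps2 S) (fkts_delta2 S) mulr1 scale1r.
apply: (conj_extension_eq (conj_extension_iter 4 theta_extension) conj_extension_id).
  by move=> X; rewrite /= !thetaT_sqr sgn2.
by move=> X; rewrite /= !thetaTinv_sqr sgn2.
Qed.

Lemma theta_order2 : delta = - eps -> th \o th =1 id.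
Proof.
move=> delta_eps; have sgn1 : - (eps * delta) = 1.
  by rewrite delta_eps mulrN opprK (fkts_eps2 S).
apply: (conj_extension_eq (conj_extension_comp theta_extension theta_extension)
  conj_extension_id).
  by move=> X; rewrite /= thetaT_sqr sgn1 scale1r.
by move=> X; rewrite /= thetaTinv_sqr sgn1 scale1r.
Qed.

Lemma theta_aut : is_aut th.
Proof.
apply: (conj_extension_aut (@thetaT_linear _ _ _ _) (thetaTK S) theta_extension
  theta_order4).
exact: mxTT_theta.
Qed.

(** * The automorphism phi *)

Section Dilation.
Variable w : F.
Hypothesis w3 : w ^+ 3 = 1.
Definition dilT (X : T) : T := (w *: X.1, w ^+ 2 *: X.2).
Definition dilTinv (X : T) : T := (w ^+ 2 *: X.1, w *: X.2).

Lemma dilTK : cancel dilT dilTinv.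
Proof. by case=> x y; rewrite /dilTinv /= !scalerA -exprS -exprSr w3 !scale1r. Qed.

Lemma dilT_linear : linear dilT.
Proof.
by move=> k [x y] [x' y']; congr (_, _); rewrite /= scalerDr !scalerA mulrC.
Qed.

Lemma mxTT_dil X Y : mxTT S (dilT X) (dilT Y) = dilT \o mxTT S X Y \o dilTinv.
Proof.
apply/funext => -[x y]; case: X Y => [a1 b1] [a2 b2].
rewrite /mxTT /dilT /dilTinv /mx2 /= !fctE /opL /opK /=.
rewrite !tprodE !(scalerDr, scalerN, opprD, opprK) !scalerA.
by congr (_ *: _ - _ *: _ + (_ *: _ - _ *: _),
  - (_ *: _) + _ *: _ + (_ *: _ - _ *: _)); ring.
Qed.

Lemma dil_diag a b : dilT \o diag_op S a b \o dilTinv = diag_op S a b.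
Proof.
apply/funext => -[x y]; rewrite /diag_op /mx2 /dilT /= !fctE !op_simp !tprodE.
by rewrite !scalerA -exprS mulrCA -exprSr w3 mulr1 scale1r.
Qed.

Lemma dil_upper c d : dilT \o upper_op S c d \o dilTinv = w ^+ 2 *: upper_op S c d.
Proof.
rewrite /upper_op mx2Z; apply/funext => -[x y]; rewrite /mx2 /dilT /= !fctE.
by rewrite !op_simp opKZ scalerA -expr2.
Qed.

Lemma dil_lower c d : dilT \o lower_op S c d \o dilTinv = w *: lower_op S c d.
Proof.
rewrite /lower_op mx2Z; apply/funext => -[x y]; rewrite /mx2 /dilT /= !fctE.
by rewrite !op_simp opKZ scalerA -exprD exprS w3 mulr1.
Qed.

(** The two coordinates are exchanged, so each picks up the factor w w^2 = 1. *)
Lemma dil_theta_dil : dilT \o thT \o dilT =1 thT.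
Proof.
move=> [x y]; rewrite /dilT /thetaT /= scalerN !scalerA.
by rewrite mulrCA -exprS mulrAC -exprSr w3 mulr1 mul1r.
Qed.

Lemma dil_theta_dilinv : dilTinv \o thTinv \o dilTinv =1 thTinv.
Proof.
move=> [x y]; rewrite /dilTinv /thetaTinv /= scalerN !scalerA.
by rewrite mulrCA -exprS mulrAC -exprSr w3 mulr1 mul1r.
Qed.

(** Both sides are linear and g(U) is spanned by its homogeneous components, so
    it suffices to compare eigenvalues: conjugation by the dilation has
    eigenvalues 1, w^2 and w = w^-2 on diagonal, upper and lower generators. *)
Lemma weight_map_extension (phi : {linear gU S -> gU S}) :
  weight_map w phi -> conj_extension dilT dilTinv phi.
Proof.
move=> hphi.
have w_inv : w ^-1 = w ^+ 2.
  have w0 : w != 0 by apply/eqP => w0; move: w3;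
    rewrite w0 expr0n => /esym/eqP; rewrite oner_eq0.
  by apply: (mulfI w0); rewrite mulfV // -exprS w3.
have phiL M (LM : lin_span (calL_gens S) M) : exists hM : M \in calL_pred S,
   calL_val (phi (CalL hM, 0)).1 = dilT \o M \o dilTinv /\ (phi (CalL hM, 0)).2 = 0.
  move: M LM; apply: calL_ind => [|k M N [hM [M1 M2]] [hN [N1 N2]]|a b|c d|e f].
  - exists (rpred0 _); have -> : (CalL (rpred0 (calL_pred S)), 0) = 0 :> gU S.
      by congr pair; apply: val_inj.
    by rewrite linear0 conj_op0 //; exact: dilT_linear.
  - have hkMN : k *: M + N \in calL_pred S by rewrite rpredD // rpredZ.
    exists hkMN; have -> : (CalL hkMN, 0) = k *: (CalL hM, 0) + (CalL hN, 0) :> gU S.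
      by congr pair; [exact: val_inj | apply/esym;
        rewrite -[LHS]/(k *: (0 : T) + 0) scaler0 addr0].
    rewrite linearP /= M1 N1 M2 N2 conj_op_lin ?scaler0 ?addr0 //.
    exact: dilT_linear.
  - have hM : diag_op S a b \in calL_pred S by apply/calLP; exact: diag_op_in.
    exists hM; rewrite (hphi 0) //=; last by split=> //; apply: lin_span_gen; exists a, b.
    by rewrite expr0z dil_diag !scale1r.
  - have hM : upper_op S c d \in calL_pred S by apply/calLP; exact: upper_op_in.
    exists hM; rewrite (hphi 2) //=; last by split=> //; apply: lin_span_gen; exists c, d.
    by rewrite -exprnP dil_upper scaler0.
  have hM : lower_op S e f \in calL_pred S by apply/calLP; exact: lower_op_in.
  exists hM; rewrite (hphi (- 2)) //=; last by split=> //; apply: lin_span_gen; exists e, f.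
  (* w^-2 = w^4 = w *)
  rewrite -exprnN -exprVn w_inv -exprM (exprD w 3 1) w3 mul1r expr1.
  by rewrite dil_lower scaler0.
move=> [M [x y]].
have [hM [M1 M2]] := phiL _ (elimT (calLP S M) (calL_valP M)).
have -> : (M, (x, y)) = ((CalL hM, 0) : gU S) + ((0, (x, 0)) + (0, (0, y))).
  congr pair; first by apply: val_inj; rewrite /= !addr0.
  by rewrite add0r; congr pair; rewrite /= ?addr0 ?add0r.
rewrite !linearD (hphi 1 isT (0, (x, 0))) ?(hphi (- 1) isT (0, (0, y))) //.
rewrite expr1z exprN1 w_inv /= M1 M2 !scaler0 !addr0.
split=> //; rewrite !add0r /dilT; congr pair.
  by rewrite /= addr0 scaler0 addr0.
by rewrite /= add0r scaler0 add0r.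
Qed.

Lemma dil_order3 : iter 3 dilT =1 id.
Proof.
by case=> x y; rewrite /dilT /= !scalerA -!exprD -expr2 -exprSr w3;
  rewrite (exprM w 3 2) w3 expr1n !scale1r.
Qed.

Lemma dilinv_order3 : iter 3 dilTinv =1 id.
Proof.
by case=> x y; rewrite /dilTinv /= !scalerA -!exprD -expr2 -exprSr w3;
  rewrite (exprM w 3 2) w3 expr1n !scale1r.
Qed.

Variable phi : {linear gU S -> gU S}.
Hypothesis phi_weight : weight_map w phi.
Let phi_extension := weight_map_extension phi_weight.

Lemma weight_map_order3 : iter 3 phi =1 id.
Proof.
exact: (conj_extension_eq (conj_extension_iter 3 phi_extension) conj_extension_id
  dil_order3 dilinv_order3).
Qed.

Lemma weight_map_aut : is_aut phi.
Proof.
exact: (conj_extension_aut dilT_linear dilTK phi_extension weight_map_order3 mxTT_dil).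
Qed.

Lemma weight_map_theta : phi \o th \o phi =1 th.
Proof.
have := conj_extension_comp (conj_extension_comp phi_extension theta_extension)
  phi_extension.
move=> /conj_extension_eq/(_ theta_extension); apply; first exact: dil_theta_dil.
exact: dil_theta_dilinv.
Qed.

End Dilation.
End Extension.

(** * The action of Dic_3 *)

Theorem mainTheorem6 (F : fieldType) (char2 : 2%N \notin [pchar F])
    (char3 : 3%N \notin [pchar F]) (w : F) (w_prim : 3.-primitive_root w)
    (eps delta : F) (U : lmodType F) (S : FKTS eps delta U)
    (phi : {linear gU S -> gU S})
    (phi_weight : weight_map w phi) :
  let th := theta (S:=S) in
  [/\ is_aut th, is_aut phi, iter 4 th =1 id, iter 3 phi =1 id
    & phi \o th \o phi =1 th] /\
  (delta = - eps -> th \o th =1 id) /\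
  (forall (gT : finGroupType) (s t : gT), Dic3_presented s t ->
     exists rho : gT -> gU S -> gU S,
       [/\ left_aut_action rho, rho s =1 th, rho t =1 phi
         & delta = - eps ->
           exists (pi : {morphism [set: gT] >-> 'S_3})
                  (rho' : 'S_3 -> gU S -> gU S),
             [/\ (pi @* [set: gT] = [set: 'S_3])%g, ('ker pi = <[s ^+ 2]>)%g,
                 left_aut_action rho' & forall g, rho g =1 rho' (pi g)]]).
Proof.
move=> th; have w3 := prim_expr_order w_prim.
have th_aut : is_aut th := theta_aut S.
have phi_aut : is_aut phi := weight_map_aut w3 phi_weight.
split; first by split=> //; [exact: theta_order4
  | exact: weight_map_order3 w3 phi phi_weight | exact: weight_map_theta w3 phi phi_weight].
split=> [|gT s t pres]; first exact: theta_order2.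
pose a : selfmap (gU S) := th; pose b : selfmap (gU S) := phi.
have a4 : (a ^+ 4 = 1)%g by rewrite selfmap_exp; apply/funext; exact: theta_order4.
have b3 : (b ^+ 3 = 1)%g.
  by rewrite selfmap_exp; apply/funext; exact: weight_map_order3 w3 phi phi_weight.
have bab : (b * a * b = a)%g.
  by apply/funext; exact: weight_map_theta w3 phi phi_weight.
have [rho [rhoM rhoE]] := Dic3_lift pres a4 b3 bab.
have rho1 : rho 1%g = 1%g by have := rhoE 0%N 0%N; rewrite !expg0 !mulg1.
(* Elements of Dic_3 act by phi^i theta^j. *)
have rho_aut g : is_aut (rho g).
  have [[i j] ->] := Dic3_word pres g; rewrite rhoE !selfmap_exp.
  by apply: is_aut_comp; exact: is_aut_iter.
exists rho; split.
- by split=> [X|g h X|//]; rewrite ?rho1 ?rhoM.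
- by move=> X; have := rhoE 0%N 1%N; rewrite !expg0 !expg1 !mul1g => ->.
- by move=> X; have := rhoE 1%N 0%N; rewrite !expg0 !expg1 !mulg1 => ->.
move=> delta_eps; have [pi [im_pi ker_pi]] := Dic3_onto_S3 pres.
have rho_ker : {in ('ker pi)%g, rho =1 fun=> 1%g}.
  move=> g; rewrite ker_pi => /cycleP[i ->].
  have a2 : (a ^+ 2 = 1)%g by apply/funext; exact: theta_order2.
  have := rhoE 0%N (2 * i)%N.
  by rewrite !expg0 !mul1g !expgM a2 expg1n.
have [rho' [rho'M rho'E]] := morph_descent im_pi rhoM rho_ker.
have rho'1 : rho' 1%g = 1%g by rewrite -rho1 rho'E morph1.
exists pi, rho'; split=> //; last by move=> g X; rewrite rho'E.
split=> [X|x y X|x]; rewrite ?rho'1 ?rho'M //.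
have /morphimP[g _ _ ->] : x \in (pi @* [set: gT])%g by rewrite im_pi inE.
by rewrite -rho'E.
Qed.
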